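(* Let $R$ be a commutative ring, $(R^{\oplus5},R^{\oplus3},\nu)$ a net of quinary alternating forms of rank $4$ over $\operatorname{Spec}R$, and $(R^{\oplus3},R,\varphi)$ the associated symmetric bilinear form, given by the symmetric matrix $Q_\nu$ described in the context. Then the discriminant $\det Q_\nu\in R$ of $\varphi$ is a complete square in $R$.
   Context: A net of quinary alternating forms of rank $4$ over $\operatorname{Spec}R$, in the free case, is a surjective $R$-linear map $\nu\colon\wedge^2R^{\oplus5}\to R^{\oplus3}$ such that every form of the net has rank $4$, i.e. $\mathbb{P}(R^{\oplus3})\cap\operatorname{Gr}(R^{\oplus5},2)=\emptyset$ in $\mathbb{P}(\wedge^2R^{\oplus5})$, where $\mathbb{P}$ and $\operatorname{Gr}(-,2)$ parametrize locally free quotients of rank $1$ and $2$ and $\operatorname{Gr}$ is Plücker embedded (equivalently: for every ring map $R\to k$ to an algebraically closed field and every nonzero linear functional $\lambda$ on $k^3$, the alternating form $\lambda\circ\nu_k$ on $k^5$ has rank $4$). Let $\alpha,\beta,\gamma$ be the standard basis of $R^{\oplus3}$ and let $A,B,C$ be the three alternating $5\times5$ matrices over $R$ with $\nu(e_i\wedge e_j)=A_{ij}\alpha+B_{ij}\beta+C_{ij}\gamma$. For a $5\times5$ matrix $X$ let $X_j$ denote the $4\times4$ matrix obtained by deleting the $j$-th row and column, and let $\operatorname{Pf}$ be the Pfaffian. Let $M$ be the $6\times5$ matrix whose $j$-th column has entries (from top to bottom) $\operatorname{Pf}(A_j)$; $\operatorname{Pf}(B_j+C_j)-\operatorname{Pf}(B_j)-\operatorname{Pf}(C_j)$;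 $\operatorname{Pf}(B_j)$; $\operatorname{Pf}(C_j+A_j)-\operatorname{Pf}(C_j)-\operatorname{Pf}(A_j)$; $\operatorname{Pf}(C_j)$; $\operatorname{Pf}(A_j+B_j)-\operatorname{Pf}(A_j)-\operatorname{Pf}(B_j)$. Let $M_i$ be the $5\times5$ matrix obtained from $M$ by deleting the $i$-th row, and $$Q_\nu=\begin{pmatrix}\det M_1&-\det M_6&-\det M_4\\-\det M_6&\det M_3&-\det M_2\\-\det M_4&-\det M_2&\det M_5\end{pmatrix}.$$ $M$ is the matrix of the map $G_\nu\colon\wedge^4R^{\oplus5}\to S^2R^{\oplus3}$ obtained by composing $a\wedge b\wedge c\wedge d\mapsto(a\wedge b)(c\wedge d)-(a\wedge c)(b\wedge d)+(a\wedge d)(b\wedge c)$ with $S^2\nu$. Its cokernel is free of rank one, identified with $R$ so that the quotient map $\varphi\colon S^2R^{\oplus3}\to R$ has Gram matrix $Q_\nu$ with respect to $\alpha,\beta,\gamma$; this is the associated symmetric bilinear form. *)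

(* Defs.v *)
From mathcomp Require Import all_boot all_order all_algebra.

Set Implicit Arguments.
Unset Strict Implicit.
Unset Printing Implicit Defensive.

Import GRing.Theory.
Local Open Scope ring_scope.

(* The exterior square of R^n, as the free module on the e_i /\ e_j, i < j.
   comPzRingType does not assume 1 != 0, so the zero ring is allowed. *)
Notation ext2 R n := {ffun {p : 'I_n * 'I_n | (p.1 < p.2)%N} -> R^o}.

Definition wedge (R : comPzRingType) (n : nat) (u v : 'rV[R]_n) : ext2 R n :=
  [ffun p => u 0 (val p).1 * v 0 (val p).2 - u 0 (val p).2 * v 0 (val p).1].

Section Net.

Variables (R : comPzRingType) (nu : {linear ext2 R 5 -> 'rV[R]_3}).

Definition nu_basis (i j : 'I_5) : 'rV[R]_3 :=
  nu (wedge (delta_mx 0 i) (delta_mx 0 j)).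

(* The Gram matrix over k of the alternating form l o nu_k on k^5, where nu_k
   is the base change of nu along f and the functional l on k^3 is the column
   of its values on the standard basis. *)
Definition form_at (k : closedFieldType) (f : {rmorphism R -> k})
    (l : 'cV[k]_3) : 'M[k]_5 :=
  \matrix_(i, j) (map_mx f (nu_basis i j) *m l) 0 0.

Definition net_of_rank4 : Prop :=
  (forall v : 'rV[R]_3, exists w, nu w = v) /\
  (forall (k : closedFieldType) (f : {rmorphism R -> k}) (l : 'cV[k]_3),
     l != 0 -> \rank (form_at f l) = 4%N).

(* The matrices A, B, C for c = 0, 1, 2. *)
Definition coord_form (c : 'I_3) : 'M[R]_5 :=
  \matrix_(i, j) nu_basis i j 0 c.

Definition pf4 (X : 'M[R]_4) : R :=
  X 0 1 * X 2 3 - X 0 2 * X 1 3 + X 0 3 * X 1 2.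

Definition pf_del (X : 'M[R]_5) (j : 'I_5) : R := pf4 (row' j (col' j X)).

Definition pf_polar (X Y : 'M[R]_5) (j : 'I_5) : R :=
  pf_del (X + Y) j - pf_del X j - pf_del Y j.

(* Rows: alpha^2, beta gamma, beta^2, gamma alpha, gamma^2, alpha beta. *)
Definition netM : 'M[R]_(6, 5) :=
  let A := coord_form 0 in let B := coord_form 1 in let C := coord_form 2 in
  \matrix_(i < 6, j < 5)
    [:: pf_del A j; pf_polar B C j; pf_del B j;
        pf_polar C A j; pf_del C j; pf_polar A B j]`_i.

(* Rows are numbered from 0: the minor M_i of the usual numbering from 1 is
   netM_minor (i - 1). *)
Definition netM_minor (i : 'I_6) : R := \det (row' i netM).

Definition Qnu : 'M[R]_3 :=
  let d := netM_minor in
  \matrix_(i < 3, j < 3)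
    (nth [::] [:: [:: d 0; - d 5; - d 3];
                  [:: - d 5; d 2; - d 1];
                  [:: - d 3; - d 1; d 4]] i)`_j.

End Net.

(* Main.v *)
(** Write p_AA, p_BB, p_CC for the vectors of signed sub-Pfaffians of A, B, C
    and p_AB, p_BC, p_CA for their polarizations; up to column signs they are
    the rows of M.  Polarizing the identity p(W) W = 0 gives p_AA A = 0,
    p_AB A = - p_AA B and so on, so that all the values A(p_XY, p_ZT),
    B(p_XY, p_ZT), C(p_XY, p_ZT) needed below are, up to sign, entries of a
    symmetric 3 x 3 matrix q of forms of degree 5 in nu, for instance
    q11 = A(p_AB, p_CA) and q12 = C(p_AA, p_BB).
    Moreover det(v1, v2, v3, v4, p(W)) is the Pfaffian of the Gram matrix
    (W(vi, vj)), and each maximal minor of M contains p_AA or p_BB.  Hence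
    the minors are quadratic in q: in fact Q_nu = adj(q), so that
    det Q_nu = (det q)^2. *)
Require Import Defs.
From mathcomp Require Import all_boot all_order all_algebra ring.
Set Implicit Arguments.
Unset Strict Implicit.
Unset Printing Implicit Defensive.
Import GRing.Theory.
Local Open Scope ring_scope.

(* Matrices are represented by functions on nat, so that a concrete
   determinant or Pfaffian reduces to a polynomial by computation, without
   any normalization of ordinals. *)
Section NatEntries.

Variable R : comPzRingType.
Implicit Types x y : nat -> nat -> R.

Definition entries m n (X : 'M[R]_(m, n)) x : Prop :=
  forall i j, X i j = x i j.

Lemma exists_entries m n (X : 'M[R]_(m, n)) : exists x, entries X x.
Proof.
exists (fun i j =>
  if insub i is Some i' then if insub j is Some j' then X i' j' else 0 else 0).
by move=> i j; rewrite !valK.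
Qed.

Fixpoint nat_sum (n : nat) (F : nat -> R) : R :=
  if n is m.+1 then nat_sum m F + F m else 0.

Lemma nat_sumE n (F : nat -> R) : \sum_(i < n) F i = nat_sum n F.
Proof. by elim: n => [|n IHn]; rewrite ?big_ord0 // big_ord_recr IHn. Qed.

Definition nat_mul (n : nat) x y : nat -> nat -> R :=
  fun i j => nat_sum n (fun k => x i k * y k j).

Lemma entries_mul m n p (X : 'M[R]_(m, n)) (Y : 'M[R]_(n, p)) x y :
  entries X x -> entries Y y -> entries (X *m Y) (nat_mul n x y).
Proof.
move=> xE yE i j; rewrite mxE /nat_mul -nat_sumE.
by apply: eq_bigr => k _; rewrite xE yE.
Qed.

Lemma entries_add m n (X Y : 'M[R]_(m, n)) x y :
  entries X x -> entries Y y -> entries (X + Y) (fun i j => x i j + y i j).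
Proof. by move=> xE yE i j; rewrite mxE xE yE. Qed.

Lemma entries_tr m n (X : 'M[R]_(m, n)) x :
  entries X x -> entries X^T (fun i j => x j i).
Proof. by move=> xE i j; rewrite mxE. Qed.

Lemma entries_col' m n (X : 'M[R]_(m, n)) x j :
  entries X x -> entries (col' j X) (fun i k => x i (bump j k)).
Proof. by move=> xE i k; rewrite mxE xE. Qed.

Lemma entries_row' m n (X : 'M[R]_(m, n)) x i :
  entries X x -> entries (row' i X) (fun k j => x (bump i k) j).
Proof. by move=> xE k j; rewrite mxE xE. Qed.

Fixpoint nat_det (n : nat) x : R :=
  if n is m.+1 then
    nat_sum n (fun j =>
      x 0%N j * ((-1) ^+ j * nat_det m (fun i k => x i.+1 (bump j k))))
  else 1.

Lemma nat_detS n x :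
  nat_det n.+1 x =
  \sum_(j < n.+1)
    x 0%N j * ((-1) ^+ j * nat_det n (fun i k => x i.+1 (bump j k))).
Proof.
by rewrite (nat_sumE _ (fun j =>
  x 0%N j * ((-1) ^+ j * nat_det n (fun i k => x i.+1 (bump j k))))).
Qed.

Lemma det_entries n (X : 'M[R]_n) x : entries X x -> \det X = nat_det n x.
Proof.
elim: n X x => [|n IHn] X x xE; first by rewrite det_mx00.
rewrite (expand_det_row _ ord0) nat_detS; apply: eq_bigr => j _.
rewrite xE /cofactor; congr (_ * (_ * _)); apply: IHn => i k.
by rewrite !mxE xE.
Qed.

Definition nat_pf4 x : R :=
  x 0%N 1%N * x 2%N 3%N - x 0%N 2%N * x 1%N 3%N + x 0%N 3%N * x 1%N 2%N.

Lemma pf4_entries (X : 'M[R]_4) x : entries X x -> pf4 X = nat_pf4 x.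
Proof. by move=> xE; rewrite /pf4 !xE. Qed.

Definition nat_pf_del x (j : nat) : R :=
  nat_pf4 (fun i k => x (bump j i) (bump j k)).

Lemma pf_del_entries (X : 'M[R]_5) x j :
  entries X x -> pf_del X j = nat_pf_del x j.
Proof. by move=> xE; exact: pf4_entries (entries_row' j (entries_col' j xE)). Qed.

(** The diagonal is prescribed separately because 2 may be a zero divisor in [R]. *)
Definition alternating n (W : 'M[R]_n) : Prop :=
  (forall i, W i i = 0) /\ (forall i j, W j i = - W i j).

(** Only the entries above the diagonal are read, so that an identity for alternating matrices
    becomes a polynomial identity in free variables. *)
Definition skew x (i j : nat) : R :=
  if (i < j)%N then x i j else if (j < i)%N then - x j i else 0.

Lemma alternating_entries n (X : 'M[R]_n) :
  alternating X -> exists x, entries X (skew x).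
Proof.
case=> X0 XN; have [x xE] := exists_entries X.
exists x => i j; rewrite /skew; case: ltngtP => [_|_|ij].
- exact: xE.
- by rewrite XN xE.
- by rewrite (ord_inj ij) X0.
Qed.

End NatEntries.

(** * Sub-Pfaffians of alternating matrices of order 5 *)

Section Pfaffian.

Variable R : comPzRingType.
Implicit Types W X Y : 'M[R]_5.

(** This is the Cauchy-Binet formula for Pfaffians; it is checked by expanding both sides as
    polynomials in the entries of [Y] and the upper entries of [W]. *)
Lemma alternating_pf4_congr W (Y : 'M[R]_(4, 5)) :
  alternating W ->
  pf4 (Y *m W *m Y^T) = \sum_j pf_del W j * \det (col' j Y).
Proof.
case/alternating_entries=> w wE; have [y yE] := exists_entries Y.
rewrite (pf4_entries (entries_mul (entries_mul yE wE) (entries_tr yE))).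
under eq_bigr do rewrite (pf_del_entries _ wE) (det_entries (entries_col' _ yE)).
rewrite (nat_sumE _ (fun j => nat_pf_del (skew w) j *
                              nat_det 4 (fun i k => y i (bump j k)))).
by rewrite /nat_pf_del /nat_pf4 /nat_mul /skew /bump /= /bump /=; ring.
Qed.

(** In the expansion along row [i0], the signs in that row cancel the column signs of the cofactors;
    what remains is the Cauchy-Binet sum above. *)
Lemma det_pf_row W X i0 :
  alternating W -> (forall j, X i0 j = (-1) ^+ j * pf_del W j) ->
  \det X = (-1) ^+ i0 * pf4 (row' i0 X *m W *m (row' i0 X)^T).
Proof.
move=> altW Xi0; rewrite alternating_pf4_congr // (expand_det_row _ i0).
rewrite big_distrr /=.
apply: eq_bigr => j _; rewrite Xi0 /cofactor exprD.
have -> : col' j (row' i0 X) = row' i0 (col' j X).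
  by apply/matrixP => i k; rewrite !mxE.
have sign2 : (-1) ^+ j * (-1) ^+ j = 1 :> R by rewrite -expr2 sqrr_sign.
move: sign2; move: ((-1) ^+ j) => e sign2.
by ring: sign2.
Qed.

Definition pf_row X : 'rV[R]_5 := \row_j ((-1) ^+ j * pf_del X j).
Definition pf_row2 X Y : 'rV[R]_5 := \row_j ((-1) ^+ j * pf_polar X Y j).

Lemma pf_row2C X Y : pf_row2 X Y = pf_row2 Y X.
Proof. by apply/rowP => j; rewrite !mxE /pf_polar [Y + X]addrC addrAC. Qed.

Lemma entries_pf_row X x :
  entries X x -> entries (pf_row X) (fun _ j => (-1) ^+ j * nat_pf_del x j).
Proof. by move=> xE i j; rewrite mxE (pf_del_entries _ xE). Qed.

Lemma entries_pf_row2 X Y x y :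
  entries X x -> entries Y y ->
  entries (pf_row2 X Y) (fun _ j => (-1) ^+ j *
    (nat_pf_del (fun i k => x i k + y i k) j
     - nat_pf_del x j - nat_pf_del y j)).
Proof.
move=> xE yE i j; rewrite mxE /pf_polar (pf_del_entries _ xE).
by rewrite (pf_del_entries _ yE) (pf_del_entries _ (entries_add xE yE)).
Qed.

(** Up to sign, entry [j] expands the Pfaffian of the alternating matrix of order 6 obtained from
    [X] by repeating index [j], hence it vanishes. *)
Lemma pf_row_mul X : alternating X -> pf_row X *m X = 0.
Proof.
case/alternating_entries=> x xE; apply/rowP => j.
rewrite (entries_mul (entries_pf_row xE) xE) mxE.
case: j => [[|[|[|[|[|j]]]]] ltj] //=;
  by rewrite /nat_pf_del /nat_pf4 /nat_mul /skew /bump /=; ring.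
Qed.

(** This is the coefficient of t in the identity [pf_row_mul] for X + tY. *)
Lemma pf_row2_mul X Y : alternating X -> alternating Y ->
  pf_row2 X Y *m X = - (pf_row X *m Y).
Proof.
case/alternating_entries=> x xE; case/alternating_entries=> y yE; apply/rowP => j.
rewrite (entries_mul (entries_pf_row2 xE yE) xE) mxE.
rewrite (entries_mul (entries_pf_row xE) yE).
case: j => [[|[|[|[|[|j]]]]] ltj] //=;
  by rewrite /nat_pf_del /nat_pf4 /nat_mul /skew /bump /=; ring.
Qed.

Definition bil W (u v : 'rV[R]_5) : R := (u *m W *m v^T) 0 0.

Lemma bilC W u v : alternating W -> bil W u v = - bil W v u.
Proof.
case=> _ WN; have WT : W^T = - W by apply/matrixP => i j; rewrite !mxE WN.
rewrite /bil -[u *m W *m v^T]trmxK [in LHS]mxE !trmx_mul !trmxK WT.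
by rewrite mulNmx mulmxN mxE mulmxA.
Qed.

Lemma bil_pf_row W v : alternating W -> bil W (pf_row W) v = 0.
Proof. by move=> altW; rewrite /bil pf_row_mul // mul0mx mxE. Qed.

Lemma bil_pf_row2 X Y v : alternating X -> alternating Y ->
  bil X (pf_row2 X Y) v = - bil Y (pf_row X) v.
Proof. by move=> altX altY; rewrite /bil pf_row2_mul // mulNmx mxE. Qed.

Lemma gram_entry m (Y : 'M[R]_(m, 5)) W a b :
  (Y *m W *m Y^T) a b = bil W (row a Y) (row b Y).
Proof.
by rewrite /bil -row_mul !mxE; apply: eq_bigr => k _; rewrite !mxE.
Qed.

End Pfaffian.

(** * Minors of M as Pfaffians of Gram matrices *)

Lemma coord_form_alternating (R : comPzRingType)
    (nu : {linear ext2 R 5 -> 'rV[R]_3}) c :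
  alternating (coord_form nu c).
Proof.
split=> [i | i j]; rewrite !mxE /nu_basis.
  suff -> : wedge (delta_mx 0 i) (delta_mx 0 i) = 0 :> ext2 R 5.
    by rewrite raddf0 mxE.
  by apply/ffunP => p; rewrite !ffunE mulrC subrr.
suff -> : wedge (delta_mx 0 j) (delta_mx 0 i) =
          - wedge (delta_mx 0 i) (delta_mx 0 j) :> ext2 R 5.
  by rewrite raddfN mxE.
by apply/ffunP => p; rewrite !ffunE opprB; congr (_ - _); apply: mulrC.
Qed.

(** When a surviving row is the Pfaffian vector of [W], the minor reduces to the Gram matrix of [W]
    on the other four rows. The nested [bump] recovers their positions in [s]. *)
Lemma det_minor_pf (R : comPzRingType) (W : 'M[R]_5) (s : seq 'rV[R]_5)
    (i : 'I_6) (k : 'I_5) :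
  alternating W -> nth 0 s (bump i k) = pf_row W ->
  \det (row' i (\matrix_(a < 6) nth 0 s a)) =
    (-1) ^+ k * nat_pf4 (fun a b =>
      bil W (nth 0 s (bump i (bump k a))) (nth 0 s (bump i (bump k b)))).
Proof.
move=> altW sk; rewrite (@det_pf_row _ W _ k) //; last first.
  by move=> j; rewrite !mxE /= sk mxE.
congr (_ * _); apply: pf4_entries => a b; rewrite gram_entry.
have rowE c : row c (row' k (row' i (\matrix_(a < 6) nth 0 s a))) =
    nth 0 s (bump i (bump k c)).
  by apply/rowP => j; rewrite !mxE.
by rewrite !rowE.
Qed.

(* The five column signs have product 1. *)
Lemma netM_minor_signed (R : comPzRingType)
    (nu : {linear ext2 R 5 -> 'rV[R]_3}) i :
  let A := coord_form nu 0 in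
  let B := coord_form nu 1 in
  let C := coord_form nu 2 in
  netM_minor nu i =
    \det (row' i (\matrix_(a < 6)
      nth 0 [:: pf_row A; pf_row2 B C; pf_row B;
                pf_row2 C A; pf_row C; pf_row2 A B] a)).
Proof.
move=> A B C; pose D : 'M[R]_5 := diag_mx (\row_j (-1) ^+ j).
have detD : \det D = 1.
  by rewrite det_diag !big_ord_recl big_ord0 !mxE /= /bump /=; ring.
rewrite /netM_minor -[LHS]mulr1 -detD -det_mulmx; congr (\det _).
apply/matrixP => a j; rewrite mul_mx_diag !mxE mulrC.
by case: (lift i a) => [[|[|[|[|[|[|b]]]]]] ltb] //=; rewrite mxE.
Qed.

Lemma det_mx33_seq (R : comPzRingType) (s : seq (seq R)) :
  \det (\matrix_(i < 3, j < 3) (nth [::] s i)`_j) =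
    nat_det 3 (fun i j => (nth [::] s i)`_j).
Proof. by apply: det_entries => i j; rewrite mxE. Qed.

Theorem proposition1p8 (R : comPzRingType)
    (nu : {linear ext2 R 5 -> 'rV[R]_3}) (hnu : net_of_rank4 nu) :
  exists r : R, \det (Qnu nu) = r ^+ 2.
Proof.
have := netM_minor_signed nu; cbv zeta.
have := @coord_form_alternating _ nu 0; have := @coord_form_alternating _ nu 1.
have := @coord_form_alternating _ nu 2.
rewrite /Qnu det_mx33_seq /=.
move: (coord_form nu 0) (coord_form nu 1) (coord_form nu 2).
move=> A B C altC altB altA.
move: (netM_minor nu) => d dE.
pose aa := pf_row A; pose bb := pf_row B; pose cc := pf_row C.
pose bc := pf_row2 B C; pose ca := pf_row2 C A; pose ab := pf_row2 A B.
have Bbb v : bil B bb v = 0 by exact: bil_pf_row.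
have Ccc v : bil C cc v = 0 by exact: bil_pf_row.
have Aab v : bil A ab v = - bil B aa v by exact: bil_pf_row2.
have Bbc v : bil B bc v = - bil C bb v by exact: bil_pf_row2.
have Cca v : bil C ca v = - bil A cc v by exact: bil_pf_row2.
have Bab v : bil B ab v = - bil A bb v.
  by rewrite /ab pf_row2C; apply: bil_pf_row2.
have Cbc v : bil C bc v = - bil B cc v.
  by rewrite /bc pf_row2C; apply: bil_pf_row2.
have Aca v : bil A ca v = - bil C aa v.
  by rewrite /ca pf_row2C; apply: bil_pf_row2.
(* Each of the two triples is an orbit of the cyclic shift A -> B -> C -> A. *)
pose q11 := bil A ab ca; pose q22 := bil B bc ab; pose q33 := bil C ca bc.
pose q23 := bil A bb cc; pose q31 := bil B cc aa; pose q12 := bil C aa bb.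
have cA u v : bil A u v = - bil A v u by exact: bilC.
have cB u v : bil B u v = - bil B v u by exact: bilC.
have cC u v : bil C u v = - bil C v u by exact: bilC.
have Abcbb : bil A bc bb = - q22 by rewrite /q22 (cB bc) (cA bc) Bab opprK.
have Abcca : bil A bc ca = q31 by rewrite cA Aca opprK cC Cbc opprK.
have Abccc : bil A bc cc = q33 by rewrite /q33 Cca cA.
have Abcab : bil A bc ab = - q12 by rewrite cA Aab opprK cB Bbc opprK cC.
have Abbca : bil A bb ca = q12 by rewrite cA Aca opprK.
have Abbab : bil A bb ab = 0 by rewrite cA Aab opprK cB Bbb oppr0.
have Acacc : bil A ca cc = 0 by rewrite Aca cC Ccc !oppr0.
have Acaab : bil A ca ab = - q11 by rewrite cA.
have Accab : bil A cc ab = - q31 by rewrite cA Aab opprK cB.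
have Bbcca : bil B bc ca = q23 by rewrite Bbc (cC bb) opprK Cca -cA.
have Bbccc : bil B bc cc = 0 by rewrite Bbc cC Ccc !oppr0.
have Bcacc : bil B ca cc = - q33 by rewrite cB /q33 (cC ca) Cbc opprK.
have Bccab : bil B cc ab = q23 by rewrite cB Bab opprK.
(* The minors are those of the symmetric matrix q, that is, Q_nu = adj(q). *)
have d0 : d 0 = q22 * q33 - q23 ^+ 2.
  (* Deleting row 0 removes [aa], so B is used, with [bb] now in position 1. B(ca, ab) needs no
     evaluation: its factor B(bc, cc) is zero. The other minors keep [aa] in position 0 and use
     A. *)
  rewrite dE (@det_minor_pf _ B _ 0 1) // /nat_pf4 /=
    -/bb -/cc -/bc -/ca -/ab.
  by rewrite Bbcca Bbccc Bcacc Bccab -/q22; ring.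
have d1 : d 1 = q11 * q23 - q12 * q31.
  rewrite dE (@det_minor_pf _ A _ _ 0) // /nat_pf4 /=
    -/bb -/cc -/bc -/ca -/ab.
  by rewrite Abbca Acaab Accab Abbab Acacc -/q23; ring.
have d2 : d 2%:R = q11 * q33 - q31 ^+ 2.
  rewrite dE (@det_minor_pf _ A _ _ 0) // /nat_pf4 /=
    -/bb -/cc -/bc -/ca -/ab.
  by rewrite Abcca Accab Abccc Abcab Acacc Acaab; ring.
have d3 : d 3%:R = q31 * q22 - q12 * q23.
  rewrite dE (@det_minor_pf _ A _ _ 0) // /nat_pf4 /=
    -/bb -/cc -/bc -/ca -/ab.
  by rewrite Abcbb Accab Abccc Abbab Abcab -/q23; ring.
have d4 : d 4%:R = q11 * q22 - q12 ^+ 2.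
  rewrite dE (@det_minor_pf _ A _ _ 0) // /nat_pf4 /=
    -/bb -/cc -/bc -/ca -/ab.
  by rewrite Abcbb Acaab Abcca Abbab Abcab Abbca; ring.
have d5 : d 5%:R = q12 * q33 - q31 * q23.
  rewrite dE (@det_minor_pf _ A _ _ 0) // /nat_pf4 /=
    -/bb -/cc -/bc -/ca -/ab.
  by rewrite Abcbb Acacc Abcca Abccc Abbca -/q23; ring.
(* The square root is det q. *)
exists (q11 * q22 * q33 + 2%:R * q12 * q23 * q31
        - q11 * q23 ^+ 2 - q22 * q31 ^+ 2 - q33 * q12 ^+ 2).
rewrite /bump /= d0 d1 d2 d3 d4 d5; ring.
Qed.
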